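(* Let $f_1,f_2:[0,1]\times\mathbb{R}^2\to\mathbb{R}$ be continuous functions and let $\alpha,\beta:(C[0,1])^2\to\mathbb{R}$ be (not necessarily linear) continuous functionals. Assume there are nonnegative constants $a_i,b_i,c_i,A_i,B_i,C_i$ ($i=1,2$) such that $$|f_1(t,x,y)|\le a_1|x|+b_1|y|+c_1,\qquad |f_2(t,x,y)|\le a_2|x|+b_2|y|+c_2$$ for all $t\in[0,1]$ and all $x,y\in\mathbb{R}$, and $$|\alpha[x,y]|\le A_1|x|_C+B_1|y|_C+C_1,\qquad |\beta[x,y]|\le A_2|x|_C+B_2|y|_C+C_2$$ for all $x,y\in C[0,1]$. If for some $\theta>0$ the matrix $$M_\theta=\begin{bmatrix}\max\{\frac1\theta,\ a_1+\theta A_1\} & b_1+\theta B_1\\ a_2+\theta A_2 & \max\{\frac1\theta,\ b_2+\theta B_2\}\end{bmatrix}$$ is convergent to zero, then the nonlocal problem $$\begin{cases}x'(t)=f_1(t,x(t),y(t)),\\ y'(t)=f_2(t,x(t),y(t)),\quad t\in[0,1],\\ x(0)=\alpha[x,y],\\ y(0)=\beta[x,y]\end{cases}$$ has at least one solution $(x,y)$.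
   Context: $C[0,1]$ is the space of continuous functions $[0,1]\to\mathbb{R}$, with norm $|x|_C=\max_{t\in[0,1]}|x(t)|$. A square matrix $M$ with nonnegative elements is said to be convergent to zero if $M^k\to 0$ as $k\to\infty$. A solution of the problem is a pair $(x,y)$ of continuously differentiable real functions on $[0,1]$ satisfying both differential equations on $[0,1]$ and both initial conditions; equivalently, a pair $(x,y)\in (C[0,1])^2$ with $x(t)=\alpha[x,y]+\int_0^t f_1(s,x(s),y(s))\,ds$ and $y(t)=\beta[x,y]+\int_0^t f_2(s,x(s),y(s))\,ds$ for all $t\in[0,1]$. *)

(* Defs.v *)
From HB Require Import structures.
From mathcomp Require Import all_boot all_order all_algebra.
From mathcomp Require Import all_classical all_reals all_analysis.
Set Implicit Arguments.
Unset Strict Implicit.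
Unset Printing Implicit Defensive.
Import Order.TTheory GRing.Theory Num.Theory.
Import numFieldNormedType.Exports.
Local Open Scope classical_set_scope.
Local Open Scope ring_scope.

(* Used as a type, [I01 R] is the subtype [set_type `[0, 1]] of [R], with its
   subspace topology; [\val] is the inclusion into [R]. *)
Definition I01 (R : realType) : set R := `[0, 1].
Arguments I01 : clear implicits.

Lemma mem0_I01 (R : realType) : (0 : R) \in I01 R.
Proof. by apply/mem_set; rewrite /I01 /= in_itv /= lexx ler01. Qed.

Definition zero01 (R : realType) : I01 R := exist _ 0 (mem0_I01 R).

Definition C01 (R : realType) := continuousType (I01 R) R.

Section C01_normedModType.
Context {R : realType}.
Implicit Types (x y z : C01 R) (c : R).

Definition C01_const c : C01 R := cst c.

Lemma C01_cts x : continuous x.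
Proof. exact: (@cts_fun _ _ x). Qed.
Arguments C01_cts : clear implicits.

Lemma C01_opp_cts x : continuous (fun t => - x t).
Proof. by move=> t; apply: (@cvgN _ _ _ (nbhs t)); exact: (C01_cts x). Qed.
Arguments C01_opp_cts : clear implicits.
Definition C01_opp x : C01 R := mkcts (C01_opp_cts x).

Lemma C01_add_cts x y : continuous (fun t => x t + y t).
Proof.
move=> t; apply: (@cvgD _ _ _ (nbhs t)).
- exact: (C01_cts x).
- exact: (C01_cts y).
Qed.
Arguments C01_add_cts : clear implicits.
Definition C01_add x y : C01 R := mkcts (C01_add_cts x y).

Lemma C01_scale_cts c x : continuous (fun t => c * x t).
Proof.
by move=> t; apply: (@cvgM _ _ (nbhs t)); [exact: cvg_cst | exact: (C01_cts x)].
Qed.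
Arguments C01_scale_cts : clear implicits.
Definition C01_scale c x : C01 R := mkcts (C01_scale_cts c x).

HB.instance Definition _ := Choice.on (C01 R).

Lemma C01_addA : associative C01_add.
Proof. by move=> x y z; apply/continuousEP => t; exact: addrA. Qed.
Lemma C01_addC : commutative C01_add.
Proof. by move=> x y; apply/continuousEP => t; exact: addrC. Qed.
Lemma C01_add0 : left_id (C01_const 0) C01_add.
Proof. by move=> x; apply/continuousEP => t; exact: add0r. Qed.
Lemma C01_addN : left_inverse (C01_const 0) C01_opp C01_add.
Proof. by move=> x; apply/continuousEP => t; exact: addNr. Qed.

HB.instance Definition _ :=
  GRing.isZmodule.Build (C01 R) C01_addA C01_addC C01_add0 C01_addN.

Lemma C01_scaleA (a b : R) x :
  C01_scale a (C01_scale b x) = C01_scale (a * b) x.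
Proof. by apply/continuousEP => t; exact: mulrA. Qed.
Lemma C01_scale1 : left_id 1 C01_scale.
Proof. by move=> x; apply/continuousEP => t; exact: mul1r. Qed.
Lemma C01_scaleDr : right_distributive C01_scale +%R.
Proof. by move=> a x y; apply/continuousEP => t; exact: mulrDr. Qed.
Lemma C01_scaleDl x : {morph C01_scale^~ x : a b / a + b}.
Proof. by move=> a b; apply/continuousEP => t; exact: mulrDl. Qed.

HB.instance Definition _ := GRing.Zmodule_isLmodule.Build R (C01 R)
  C01_scaleA C01_scale1 C01_scaleDr C01_scaleDl.

(* The supremum is attained, hence a maximum: see [C01_norm_max]. *)
Definition C01_norm x : R := sup (range (fun t => `|x t|)).

Lemma C01_max x : exists t, forall s, `|x s| <= `|x t|.
Proof.
have cx : {within I01 R, continuous (fun r => `|valL x r|)}.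
  move=> r; apply: (@cvg_norm R); move: r.
  by apply/subspace_valL_continuousP => t; exact: C01_cts.
have [r r01 rmax] := EVT_max ler01 cx.
have rI : r \in I01 R by exact/mem_set.
exists (exist _ r rI) => s.
have /(_ (\val s)) := rmax; rewrite (_ : \val s \in `[0, 1]); last first.
  exact: (set_mem (valP s)).
move=> /(_ isT).
have vE (t : I01 R) : valL x (\val t) = x t
  by exact: (congr1 (fun g : I01 R -> R => g t) (valLK point (x : I01 R -> R))).
by rewrite vE (vE (exist _ r rI)).
Qed.

Lemma C01_norm_has_sup x : has_sup (range (fun t => `|x t|)).
Proof.
split; first by exists `|x (zero01 R)|, (zero01 R).
by have [t tmax] := C01_max x; exists `|x t| => _ [s _ <-].
Qed.

Lemma C01_norm_ge x t : `|x t| <= C01_norm x.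
Proof. by apply: sup_upper_bound; [exact: C01_norm_has_sup | exists t]. Qed.

Lemma C01_norm_max x : exists t, C01_norm x = `|x t|.
Proof.
have [t tmax] := C01_max x; exists t.
apply/eqP; rewrite eq_le C01_norm_ge andbT.
by apply: ge_sup; [exists `|x t|, t | move=> _ [s _ <-]].
Qed.

Lemma C01_ler_normD x y : C01_norm (x + y) <= C01_norm x + C01_norm y.
Proof.
have [t ->] := C01_norm_max (x + y).
apply: le_trans (ler_normD (x t) (y t)) _.
by apply: lerD; exact: C01_norm_ge.
Qed.

Lemma C01_normrZ c x : C01_norm (c *: x) = `|c| * C01_norm x.
Proof.
apply/eqP; rewrite eq_le; apply/andP; split.
  have [t ->] := C01_norm_max (c *: x).
  by rewrite [leLHS]normrM ler_wpM2l// C01_norm_ge.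
have [t ->] := C01_norm_max x.
rewrite -normrM; exact: (C01_norm_ge (c *: x) t).
Qed.

Lemma C01_normr0_eq0 x : C01_norm x = 0 -> x = 0.
Proof.
move=> x0; apply/continuousEP => t; apply/eqP.
by have := C01_norm_ge x t; rewrite x0 normr_le0.
Qed.

HB.instance Definition _ := Lmodule_isNormed.Build R (C01 R)
  C01_ler_normD C01_normrZ C01_normr0_eq0.

End C01_normedModType.

Definition convergent_to_zero (R : realType) (n : nat) (M : 'M[R]_n.+1) :
    Prop :=
  (fun k : nat => M ^+ k) @ \oo --> (0 : 'M[R]_n.+1).

(* The limit is taken in [0, 1], so the derivative is one-sided at 0 and 1. *)
Definition has_derivative01 (R : realType) (x : C01 R) (t : I01 R) (l : R) :
    Prop :=
  (x s - x t) / (\val s - \val t) @[s --> t^'] --> l.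

Definition is_C1 (R : realType) (x : C01 R) : Prop :=
  exists dx : C01 R, forall t : I01 R, has_derivative01 x t (dx t).

Definition is_solution (R : realType) (f1 f2 : I01 R * (R * R) -> R)
    (alpha beta : C01 R * C01 R -> R) (x y : C01 R) : Prop :=
  [/\ is_C1 x /\ is_C1 y,
      forall t : I01 R, has_derivative01 x t (f1 (t, (x t, y t))),
      forall t : I01 R, has_derivative01 y t (f2 (t, (x t, y t))),
      x (zero01 R) = alpha (x, y) &
      y (zero01 R) = beta (x, y)].

Definition M_theta (R : realType) (theta a1 b1 a2 b2 A1 B1 A2 B2 : R) :
    'M[R]_2 :=
  \matrix_(i < 2, j < 2)
    match i == 0, j == 0 with
    | true, true => Num.max (theta^-1) (a1 + theta * A1)
    | true, false => b1 + theta * B1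
    | false, true => a2 + theta * A2
    | false, false => Num.max (theta^-1) (b2 + theta * B2)
    end.

(* Main.v *)
Require Import Defs.
From mathcomp Require Import all_boot all_order all_algebra.
From mathcomp Require Import all_classical all_reals all_analysis.
From mathcomp Require Import lra ring.
Import Order.TTheory GRing.Theory Num.Theory.
Import numFieldNormedType.Exports.
Local Open Scope classical_set_scope.

(** The nonlocal conditions only constrain the pair (x(0), y(0)), so the
    infinite-dimensional fixed point theorem one would expect here (Schauder's)
    can be replaced by Brouwer's theorem in the plane, applied to approximate
    problems in which the initial values determine the solution.

    For each step 1/n, the Euler polygons started from (u, v) form a pair
    Z(u, v) in C[0,1]^2 that depends continuously on (u, v) ([euler_cts]),
    whether or not the exact initial value problem is uniquely solvable.
    Truncating alpha and beta at a large height rho gives a continuous map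
    (u, v) |-> (alpha(Z(u, v)), beta(Z(u, v))) of a square into itself, and its
    fixed point yields polygons (x_n, y_n) that satisfy the truncated nonlocal
    conditions ([truncated_euler_bvp]).  Brouwer's theorem for the square
    ([brouwer_square]) comes from Sperner's lemma on a triangulated grid
    ([sperner_square]), proved by counting edges modulo 2.

    The hypothesis on M_theta gives bounds independent of n.  A polygon obeys
    |x|_C <= |x(0)| + a1 |x|_C + b1 |y|_C + c1, and |x(0)| is at most
    A1 |x|_C + B1 |y|_C + C1; adding theta times the second inequality to the
    first shows that p = (|x|_C + theta |x(0)|, |y|_C + theta |y(0)|) satisfies
    p <= M_theta p + c ([weighted_norm_le]).  Iterating until a power of M_theta
    has small entries bounds p by a constant r ([convergent_to_zero_bound],
    [a_priori_bound]).  Choosing rho above r / theta makes the truncation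
    inactive, so the polygons satisfy the original nonlocal conditions.

    The polygons are then uniformly bounded and uniformly Lipschitz, hence
    converge uniformly along an ultrafilter on the indices ([ultra_ascoli]).
    Continuity of alpha and beta passes the initial conditions to the limit.
    The differential equations pass to the limit because the chords of a polygon
    over [s, t] are averages of slopes f(tau, x_n(tau), y_n(tau)) with tau in
    [s - 1/n, t], a property ([lagged_slope]) that also yields the norm and
    Lipschitz bounds ([lagged_slope_limit], [lagged_slope_norm],
    [lagged_slope_lipschitz]). *)

(** * Sperner's lemma on a triangulated square *)

Local Open Scope nat_scope.

Definition edge01 (a b : nat) : bool :=
  ((a == 0) && (b == 1)) (+) ((a == 1) && (b == 0)).

(** Exclusive or is addition modulo 2, which is its own inverse. *)
Lemma telescope_addb (n : nat) (F : nat -> bool) :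
  \big[addb/false]_(i < n) (F i (+) F i.+1) = F 0 (+) F n.
Proof.
elim: n => [|n IH]; first by rewrite big_ord0 addbb.
by rewrite big_ord_recr /= IH; case: (F 0); case: (F n); case: (F n.+1).
Qed.

(** If two vertices of a triangle have the same colour, the edges joining them
    to the third one are both 0-1 edges or neither is. *)
Lemma edge01_triangle (x y z : nat) : (x < 3)%N -> (y < 3)%N -> (z < 3)%N ->
  edge01 x y (+) edge01 y z (+) edge01 x z ->
  forall k, (k < 3)%N -> [|| x == k, y == k | z == k].
Proof.
case: x => [|[|[|//]]]; case: y => [|[|[|//]]]; case: z => [|[|[|//]]] //=;
by move=> _ _ _ _; case=> [|[|[|//]]].
Qed.

(** Cut each cell of the grid along its diagonal and count, modulo 2, the 0-1
    edges of all the triangles.  Interior edges are counted twice, and the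
    boundary conditions leave no 0-1 edge on the left, right and top sides,
    while the bottom side goes from a corner of colour 0 to one of colour 1
    using only these colours.  The count is therefore odd, so some triangle has
    all three colours; the conclusion only retains the cell containing it. *)
Lemma sperner_square (n : nat) (c : nat -> nat -> nat) :
  (forall i j, (c i j < 3)%N) ->
  (forall i, (i <= n)%N -> c i 0 != 2) ->
  (forall i, (i <= n)%N -> c i n != 0) ->
  (forall j, (j <= n)%N -> c 0 j != 1) ->
  (forall j, (j <= n)%N -> c n j != 0) ->
  exists i j, [/\ (i < n)%N, (j < n)%N &
    forall k, (k < 3)%N -> exists di dj : bool, c (i + di)%N (j + dj)%N = k].
Proof.
move=> c3 bot top left right.
pose h i j := edge01 (c i j) (c i.+1 j).
pose v i j := edge01 (c i j) (c i j.+1).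
pose d i j := edge01 (c i j) (c i.+1 j.+1).
pose lower i j := h i j (+) v i.+1 j (+) d i j.
pose upper i j := v i j (+) h i j.+1 (+) d i j.
have cell i j : lower i j (+) upper i j =
    (h i j (+) h i j.+1) (+) (v i j (+) v i.+1 j).
  rewrite /lower /upper; case: (h i j); case: (h i j.+1); case: (v i j);
  by case: (v i.+1 j); case: (d i j).
have total :
    \big[addb/false]_(i < n) \big[addb/false]_(j < n) (lower i j (+) upper i j).
  under eq_bigr => i _ do under eq_bigr => j _ do
    rewrite cell.
  under eq_bigr => i _ do rewrite big_split /=.
  rewrite big_split /= [X in _ (+) X]exchange_big /=.
  rewrite [X in _ (+) X]big1 ?addbF; last first.
    move=> j _; rewrite (telescope_addb n (fun i => v i j)) /v /edge01.
    have := left j (ltnW (ltn_ord j)); have := left _ (ltn_ord j).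
    have := right j (ltnW (ltn_ord j)); have := right _ (ltn_ord j).
    by do 4 move=> /negPf->; rewrite !andbF.
  (* Between the colours 0 and 1, a 0-1 edge is a change of the test c = 1. *)
  rewrite (eq_bigr (fun i : 'I_n => (c i 0 == 1) (+) (c i.+1 0 == 1)));
    last first.
    move=> i _; rewrite (telescope_addb n (fun j => h i j)) /h /edge01.
    have := top i (ltnW (ltn_ord i)); have := top _ (ltn_ord i).
    do 2 move=> /negPf->; rewrite !andbF addbF.
    have := bot i (ltnW (ltn_ord i)); have := bot _ (ltn_ord i).
    have := c3 i 0; have := c3 i.+1 0.
    by case: (c i 0) => [|[|[|//]]]; case: (c i.+1 0) => [|[|[|//]]].
  rewrite (telescope_addb n (fun i => c i 0 == 1)) (negPf (left 0 _))//=.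
  have := c3 n 0; have := right 0 (leq0n n); have := bot n (leqnn n).
  by case: (c n 0) => [|[|[|//]]].
have [/existsP[i /existsP[j ij]]|/existsPn none] :=
    boolP [exists i : 'I_n, exists j : 'I_n, lower i j (+) upper i j];
    last first.
  rewrite big1 // in total => i _; apply: big1 => j _.
  by have /existsPn/(_ j)/negPf := none i.
exists i, j; split => // k k3.
have [lo|/negPf lo] := boolP (lower i j).
  have /or3P[/eqP|/eqP|/eqP] :=
    edge01_triangle _ _ _ (c3 _ _) (c3 _ _) (c3 _ _) lo _ k3.
  - by exists false, false; rewrite !addn0.
  - by exists true, false; rewrite addn1 addn0.
  - by exists true, true; rewrite !addn1.
rewrite lo /= in ij.
have /or3P[/eqP|/eqP|/eqP] :=
    edge01_triangle _ _ _ (c3 _ _) (c3 _ _) (c3 _ _) ij _ k3.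
- by exists false, false; rewrite !addn0.
- by exists false, true; rewrite addn1 addn0.
- by exists true, true; rewrite !addn1.
Qed.

(** * Brouwer's fixed point theorem in the square *)

Local Open Scope ring_scope.

(** A cluster point of an ultrafilter is a limit: a neighbourhood that does not
    belong to the ultrafilter has its complement in it. *)
Lemma ultra_compact_cvg (I : Type) (U : set_system I) {UU : UltraFilter U}
    (T : topologicalType) (A : set T) (u : I -> T) :
  compact A -> (forall i, A (u i)) -> exists2 l, A l & u @ U --> l.
Proof.
move=> cA Au.
have [l [Al clu]] : A `&` cluster (u @ U) !=set0.
  apply: cA; rewrite nbhs_simpl.
  by apply: (@filterS _ U _ setT) => [i _|]; [exact: Au|exact: filterT].
exists l => // B Bl; have [//|UnB] := in_ultra_setVsetC (u @^-1` B) UU.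
by have [x [nBx Bx]] := clu (~` B) B UnB Bl.
Qed.

(** Colour a point p of a fine grid by 1 if f decreases the first coordinate,
    else by 2 if g decreases the second one, else by 0.  Sperner's lemma gives
    cells with vertices of all three colours; along an ultrafilter the cells
    shrink to one point, where the three sign conditions pass to the limit and
    leave only equalities. *)
Lemma brouwer_square (R : realType) (r : R) (f g : R * R -> R) :
  0 < r -> continuous f -> continuous g ->
  (forall p, `|f p| <= r) -> (forall p, `|g p| <= r) ->
  exists p, f p = p.1 /\ g p = p.2.
Proof.
move=> r0 cf cg fr gr.
pose x (n i : nat) : R := - r + 2 * r * (i%:R / n%:R).
have x0 n : x n 0 = - r by rewrite /x mulr0n mul0r mulr0 addr0.
have xn n : x n.+1 n.+1 = r by rewrite /x divff// mulr1; lra.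
pose pt n i j := (x n i, x n j).
(* The far sides are coloured as though f and g decreased strictly there, so
   that equality on these sides does not break the boundary conditions. *)
pose c n i j : nat :=
  if (i == n) || (f (pt n i j) < x n i) then 1%N else
  if (j == n) || (g (pt n i j) < x n j) then 2%N else 0%N.
have cell n : exists ij : nat * nat, [/\ (ij.1 < n.+1)%N, (ij.2 < n.+1)%N &
    forall k, (k < 3)%N -> exists di dj : bool,
      c n.+1 (ij.1 + di)%N (ij.2 + dj)%N = k].
  have [|i|i|j|j|i [j ?]] :=
    @sperner_square n.+1 (c n.+1); last by exists (i, j).
  - by move=> i j; rewrite /c; case: ifP => // _; case: ifP.
  - move=> _; rewrite /c; case: ifP => // _; rewrite ifF//= x0 ltNge.
    by have := gr (pt n.+1 i 0); rewrite ler_norml => /andP[->].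
  - by move=> _; rewrite /c eqxx; case: ifP.
  - move=> _; rewrite /c ifF; first by case: ifP.
    rewrite /= x0 ltNge.
    by have := fr (pt n.+1 0 j); rewrite ler_norml => /andP[->].
  - by move=> _; rewrite /c eqxx.
have [ij ijP] := choice cell.
pose corner n (d : bool * bool) :=
  pt n.+1 ((ij n).1 + d.1)%N ((ij n).2 + d.2)%N.
have vertex k : (k < 3)%N -> exists d : nat -> bool * bool, forall n,
    c n.+1 ((ij n).1 + (d n).1)%N ((ij n).2 + (d n).2)%N = k.
  move=> k3; suff /choice[d dP] : forall n, exists d : bool * bool,
      c n.+1 ((ij n).1 + d.1)%N ((ij n).2 + d.2)%N = k by exists d.
  by move=> n; have [_ _ /(_ k k3)[di [dj <-]]] := ijP n; exists (di, dj).
have [U [UU Uoo]] := ultraFilterLemma (F := \oo) _.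
have [l _ ql] : exists2 l, (`[- r, r] `*` `[- r, r]) l &
    (fun n => corner n (false, false)) @ U --> l.
  apply: ultra_compact_cvg.
    exact: (compact_setX (@segment_compact _ _ _) (@segment_compact _ _ _)).
  have xr n i : (i < n.+1)%N -> `[- r, r]%classic (x n.+1 i).
    move=> ilt; rewrite /= in_itv /= /x.
    have i0 : 0 <= i%:R / n.+1%:R :> R by rewrite divr_ge0.
    have i1 : i%:R / n.+1%:R <= 1 :> R.
      by rewrite ler_pdivrMr// mul1r ler_nat ltnW.
    have := mulr_ge0 (ltW r0) i0; have : 0 <= r * (1 - i%:R / n.+1%:R).
      by apply: mulr_ge0; rewrite ?subr_ge0 ?(ltW r0).
    by move: (i%:R / _) => t H1 H2; apply/andP; split; lra.
  by move=> n; have [? ? _] := ijP n; rewrite /corner !addn0; split; exact: xr.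
have cornerl (d : nat -> bool * bool) : (fun n => corner n (d n)) @ U --> l.
  have step (e : nat -> bool) :
      2 * r * ((e n)%:R / n.+1%:R) @[n --> U] --> (0 : R).
    apply: (cvg_trans (G := ((fun n => 2 * r * ((e n)%:R / n.+1%:R)) @ \oo))).
      by move=> A; exact: Uoo.
    apply: (@squeeze_cvgr _ _ _ _ (cst 0) (fun n => 2 * r * harmonic n)).
    + have r2 : 0 <= 2 * r by rewrite mulr_ge0// ltW.
      apply: nearW => n; rewrite /cst mulr_ge0 ?divr_ge0// ler_wpM2l//.
      by rewrite /harmonic; case: (e n); rewrite ?mul1r// mul0r invr_ge0.
    + exact: cvg_cst.
    + rewrite -[X in _ --> X](mulr0 (2 * r)); apply: cvgM; first exact: cvg_cst.
      exact: cvg_harmonic.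
  have xD n i e : x n.+1 (i + e)%N = x n.+1 i + 2 * r * (e%:R / n.+1%:R).
    by rewrite /x natrD (mulrDl i%:R) mulrDr addrA.
  have H1 : x n.+1 ((ij n).1 + (d n).1)%N @[n --> U] --> l.1.
    under eq_fun do rewrite xD.
    rewrite -[l.1]addr0; apply: cvgD (step _).
    have -> : (fun n => x n.+1 (ij n).1) =
        fun n => (corner n (false, false)).1.
      by apply/funext => n; rewrite /corner /= addn0.
    exact: (cvg_comp _ _ ql cvg_fst).
  have H2 : x n.+1 ((ij n).2 + (d n).2)%N @[n --> U] --> l.2.
    under eq_fun do rewrite xD.
    rewrite -[l.2]addr0; apply: cvgD (step _).
    have -> : (fun n => x n.+1 (ij n).2) =
        fun n => (corner n (false, false)).2.
      by apply/funext => n; rewrite /corner /= addn0.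
    exact: (cvg_comp _ _ ql cvg_snd).
  rewrite /corner /pt (surjective_pairing l); exact: (cvg_pair H1 H2).
have [d0 d0P] := vertex 0 isT.
have [d1 d1P] := vertex 1 isT.
have [d2 d2P] := vertex 2 isT.
have lim (h : R * R -> R) d : continuous h ->
    h (corner n (d n)) @[n --> U] --> h l.
  by move=> ch; apply: cvg_comp (cornerl d) (ch l).
have fst_cts : continuous (fst : R * R -> R) by move=> ?; exact: cvg_fst.
have snd_cts : continuous (snd : R * R -> R) by move=> ?; exact: cvg_snd.
exists l; split; apply/eqP; rewrite eq_le; apply/andP; split.
- apply: (ler_cvg_to (lim f d1 cf) (lim fst d1 fst_cts)); apply: nearW => n.
  have := d1P n; rewrite /c; case: ifP; last by case: ifP.
  case/orP => [/eqP e|/ltW//]; rewrite /corner /= e xn => _.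
  by have := fr (pt n.+1 n.+1 ((ij n).2 + (d1 n).2));
    rewrite ler_norml => /andP[].
- apply: (ler_cvg_to (lim fst d0 fst_cts) (lim f d0 cf)); apply: nearW => n.
  have := d0P n; rewrite /c; case: ifP => // /negbT.
  by rewrite negb_or -leNgt => /andP[].
- apply: (ler_cvg_to (lim g d2 cg) (lim snd d2 snd_cts)); apply: nearW => n.
  have := d2P n; rewrite /c; case: ifP => // _; case: ifP => //.
  case/orP => [/eqP e|/ltW//]; rewrite /corner /= e xn => _.
  by have := gr (pt n.+1 ((ij n).1 + (d2 n).1) n.+1);
    rewrite ler_norml => /andP[].
- apply: (ler_cvg_to (lim snd d0 snd_cts) (lim g d0 cg)); apply: nearW => n.
  have := d0P n; rewrite /c; case: ifP => // _; case: ifP => // /negbT.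
  by rewrite negb_or -leNgt => /andP[].
Qed.

(** * Euler polygons *)

(** [cvg_pair] with its limit stated as a point instead of a product filter. *)
Lemma cvg_to_pair {T : Type} {U V : topologicalType} {F : set_system T}
    {FF : Filter F} {f : T -> U} {g : T -> V} {a : U} {b : V} :
  f @ F --> a -> g @ F --> b -> (f x, g x) @[x --> F] --> (a, b).
Proof. by move=> fa gb; exact: (cvg_pair fa gb). Qed.

(** Uniform convergence makes evaluation continuous in both arguments at
    once. *)
Lemma C01_eval_cts (R : realType) :
  continuous (fun p : C01 R * I01 R => p.1 p.2).
Proof.
move=> [x t]; apply/cvgrPdist_lt => /= e e0.
have e2 : 0 < e / 2 by rewrite divr_gt0.
near=> p.
have xp : `|x - p.1| < e / 2.
  by near: p; apply: (cvgr_dist_lt fst) => //; exact: cvg_fst.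
have tp : `|x t - x p.2| < e / 2.
  near: p; apply: (cvgr_dist_lt (fun p : C01 R * I01 R => x p.2)) => //.
  by apply: cvg_comp cvg_snd _; exact: C01_cts.
have := C01_norm_ge (x - p.1) p.2; rewrite -[C01_norm _]/`|x - p.1| => xpt.
rewrite (_ : _ - _ = (x t - x p.2) + (x - p.1) p.2); last first.
  by rewrite -[(x - p.1) p.2]/(x p.2 - p.1 p.2); lra.
rewrite (le_lt_trans (ler_normD _ _))// [e](splitr e).
by rewrite ltrD// (le_lt_trans xpt).
Unshelve. all: by end_near. Qed.

Section clamp.
Context {R : realType}.
Implicit Types a b s t : R.

Definition clamp a b t : R := Num.min (Num.max t a) b.

Lemma clamp_cts a b : continuous (clamp a b).
Proof.
move=> t; apply: (@continuous_min _ _ (fun t : R => Num.max t a) (cst b)).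
  apply: (@continuous_max _ _ id (cst a)); first exact: cvg_id.
  exact: cvg_cst.
exact: cvg_cst.
Qed.

Lemma clamp_homo a b s t : s <= t -> clamp a b s <= clamp a b t.
Proof.
move=> st; rewrite /clamp le_min !ge_min lexx orbT andbT; apply/orP; left.
by rewrite ge_max !le_max st lexx orbT.
Qed.

Lemma clamp_below a b t : a <= b -> t <= a -> clamp a b t = a.
Proof. by move=> ab ta; rewrite /clamp max_r// min_l. Qed.

Lemma clamp_above a b t : a <= b -> b <= t -> clamp a b t = b.
Proof. by move=> ab bt; rewrite /clamp max_l ?min_r// (le_trans ab). Qed.

Lemma clamp_norm_le r t : 0 <= r -> `|clamp (- r) r t| <= r.
Proof.
rewrite ler_norml => r0; apply/andP; split.
  by rewrite /clamp le_min le_max lexx orbT/=; lra.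
by rewrite /clamp ge_min lexx orbT.
Qed.

Lemma clamp_norm_le_id r t : 0 <= r -> `|clamp (- r) r t| <= `|t|.
Proof.
move=> r0; have := ler_norm t; have := ler_norm (- t); rewrite normrN.
move=> t1 t2; have t0 := normr_ge0 t; rewrite ler_norml /clamp.
apply/andP; split.
  by rewrite le_min le_max; apply/andP; split; [apply/orP; left|]; lra.
by rewrite ge_min ge_max; apply/orP; left; apply/andP; split; lra.
Qed.

Lemma clamp_interior r t : `|clamp (- r) r t| < r -> clamp (- r) r t = t.
Proof.
rewrite ltr_norml /clamp lt_min gt_min lt_max !ltxx !orbF => /andP[/andP[rt _]].
by rewrite gt_max => /andP[tr _]; rewrite max_l ?min_l ?ltW.
Qed.

Lemma clamp_ramp_cts a b :
  continuous (fun t : I01 R => clamp a b (\val t) - a).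
Proof.
move=> t; apply: (@cvgB _ _ _ (nbhs t)); last exact: cvg_cst.
apply: (@continuous_comp _ _ _ (fun t : I01 R => \val t));
  last exact: clamp_cts.
exact: initial_continuous.
Qed.

(** For 0 <= a <= b, the integral from 0 to t of the indicator function of
    [a, b]. *)
Definition ramp a b : C01 R := mkcts (clamp_ramp_cts a b).

End clamp.

(** A derivative-free form of x' = G with a delay of at most h: the mean slope
    of x on [s, t] is an average of values of G taken on [s - h, t].  Unlike
    x' = G, it holds for Euler polygons, and it is stable under uniform limits
    with h tending to 0. *)
Definition lagged_slope {R : realType} (h : R) (G : I01 R -> R) (x : C01 R) :
    Prop :=
  forall s t : I01 R, \val s <= \val t -> forall L e,
    (forall tau : I01 R, \val s - h <= \val tau <= \val t ->
      `|G tau - L| <= e) ->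
    `|x t - x s - L * (\val t - \val s)| <= e * (\val t - \val s).

Section polygon.
Context {R : realType} (n : nat).
Local Notation h := (n.+1%:R^-1 : R).

Definition grid (k : nat) : R := k%:R * h.
(** Grid points beyond 1 are sent to the default value 0. *)
Definition gridI (k : nat) : I01 R := insubd (zero01 R) (grid k).
Definition grid_ramp (k : nat) : C01 R := ramp (grid k) (grid k.+1).

Lemma grid_step k : grid k.+1 = grid k + h.
Proof. by rewrite /grid -natr1 mulrDl mul1r. Qed.

Lemma step_gt0 : 0 < h.
Proof. by rewrite invr_gt0. Qed.

Lemma le_grid j k : (j <= k)%N -> grid j <= grid k.
Proof. by move=> jk; rewrite ler_wpM2r ?(ltW step_gt0)// ler_nat. Qed.

Lemma gridI_val k : (k <= n.+1)%N -> \val (gridI k) = grid k.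
Proof.
move=> kn; rewrite /gridI insubdK//; apply/mem_set; rewrite /I01 /= in_itv /=.
by rewrite mulr_ge0//= /grid ler_pdivrMr// mul1r ler_nat.
Qed.

(** The grid intervals partition [0, 1]. *)
Lemma sum_grid_ramp (t : I01 R) : \sum_(k < n.+1) grid_ramp k t = \val t.
Proof.
have /andP[t0 t1] : 0 <= \val t <= 1.
  by have := set_mem (valP t); rewrite /I01 /= in_itv /=.
have sumE m : \sum_(k < m) grid_ramp k t = Num.min (\val t) (grid m).
  elim: m => [|m IH]; first by rewrite big_ord0 /grid mul0r min_r.
  rewrite big_ord_recr /= IH /grid_ramp /= -[X in _ + X]/(clamp _ _ _ - _).
  rewrite grid_step.
  have gh : grid m <= grid m + h by rewrite lerDl ltW.
  have [tg|gt] := leP (\val t) (grid m).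
    by rewrite clamp_below// subrr addr0 !min_l// (le_trans tg).
  by rewrite /clamp max_l ?(ltW gt)// addrC subrK.
by rewrite sumE min_l// /grid divff.
Qed.

Lemma grid_ramp_homo k (s t : I01 R) :
  \val s <= \val t -> grid_ramp k s <= grid_ramp k t.
Proof. by move=> st; rewrite lerD2r clamp_homo. Qed.

Lemma grid_ramp0 j k : (j <= k)%N -> (k <= n)%N -> grid_ramp k (gridI j) = 0.
Proof.
move=> jk kn; rewrite -[LHS]/(clamp _ _ _ - _).
rewrite gridI_val ?(leq_trans jk) 1?ltnW//.
by rewrite clamp_below ?subrr// le_grid.
Qed.

(** [W k] follows the polygon of successive slopes [F] up to the [k]-th grid
    point and is constant afterwards. *)
Context (w : R) (F : nat -> R) (W : nat -> C01 R) (W0 : W 0 = C01_const w)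
  (WE : forall k, W k.+1 = W k + F k *: grid_ramp k).

Lemma polygonE k t : W k t = w + \sum_(j < k) F j * grid_ramp j t.
Proof.
elim: k => [|k IH]; first by rewrite big_ord0 addr0 W0.
by rewrite big_ord_recr /= addrA -IH WE.
Qed.

Lemma polygon_past j k : (j <= k <= n.+1)%N -> W k (gridI j) = W j (gridI j).
Proof.
elim: k => [|k IH]; first by rewrite leqn0 => /andP[/eqP->].
case/andP; rewrite leq_eqVlt => /orP[/eqP->//|]; rewrite ltnS => jk kn.
rewrite WE -[LHS]/(W k _ + F k * grid_ramp k _) grid_ramp0//.
by rewrite mulr0 addr0 IH// jk ltnW.
Qed.

(** An increment of the polygon is a combination of its slopes, whose weights
    are the nonnegative increments of the ramps and add up to t - s.  A ramp has
    a nonzero increment on [s, t] only if its interval meets [s, t], and then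
    the left end of that interval, where the slope was computed, is at least
    s - h. *)
Lemma polygon_lagged_slope (G : I01 R -> R) :
  (forall k, (k <= n)%N -> F k = G (gridI k)) -> lagged_slope h G (W n.+1).
Proof.
move=> FG s t st L e Ge.
rewrite -(sum_grid_ramp t) -(sum_grid_ramp s) !(polygonE n.+1).
pose d (k : 'I_n.+1) := grid_ramp k t - grid_ramp k s.
have -> : w + \sum_(k < n.+1) F k * grid_ramp k t
    - (w + \sum_(k < n.+1) F k * grid_ramp k s)
    - L * (\sum_(k < n.+1) grid_ramp k t - \sum_(k < n.+1) grid_ramp k s)
    = \sum_(k < n.+1) (F k - L) * d k.
  rewrite opprD addrACA subrr add0r -!sumrB mulr_sumr -sumrB.
  by apply: eq_bigr => k _; rewrite /d; ring.
rewrite -sumrB mulr_sumr (le_trans (ler_norm_sum _ _ _))// ler_sum// => k _.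
have d0 : 0 <= d k by rewrite subr_ge0 grid_ramp_homo.
rewrite normrM (ger0_norm d0) -/(d k).
have kn : (k <= n)%N by rewrite -ltnS.
have gk : grid k <= grid k.+1 by rewrite le_grid.
have [tk|kt] := leP (\val t) (grid k).
  rewrite /d -[grid_ramp k t]/(clamp _ _ _ - _).
  rewrite -[grid_ramp k s]/(clamp _ _ _ - _).
  by rewrite !clamp_below// ?(le_trans st)// subrr !mulr0.
have [ks|sk] := leP (grid k.+1) (\val s).
  rewrite /d -[grid_ramp k t]/(clamp _ _ _ - _).
  rewrite -[grid_ramp k s]/(clamp _ _ _ - _).
  by rewrite !clamp_above// ?(le_trans ks)// subrr !mulr0.
rewrite ler_wpM2r// FG// Ge// gridI_val ?(leq_trans kn)// (ltW kt) andbT.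
by rewrite lerBlDr -grid_step ltW.
Qed.

End polygon.

Section euler.
Context {R : realType} (f1 f2 : I01 R * (R * R) -> R) (n : nat).

Definition euler_slopes (xy : C01 R * C01 R) (t : I01 R) : R * R :=
  (f1 (t, (xy.1 t, xy.2 t)), f2 (t, (xy.1 t, xy.2 t))).

Fixpoint euler (uv : R * R) (k : nat) : C01 R * C01 R :=
  if k is j.+1 then
    let xy := euler uv j in
    (xy.1 + (euler_slopes xy (gridI n j)).1 *: grid_ramp n j,
     xy.2 + (euler_slopes xy (gridI n j)).2 *: grid_ramp n j)
  else (C01_const uv.1, C01_const uv.2).

Lemma C01_const_cts : continuous (@C01_const R).
Proof.
move=> u; apply/cvgrPdist_lt => e e0; near=> v.
have [t] := C01_norm_max (C01_const u - C01_const v).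
rewrite -[C01_norm _]/`|C01_const u - C01_const v| => ->.
rewrite -[X in `|X|]/(u - v); near: v.
exact: (cvgr_dist_lt id).
Unshelve. all: by end_near. Qed.

(** The data enter only through finitely many evaluations of f1 and f2, so
    their continuity is enough. *)
Lemma euler_cts (k : nat) : continuous f1 -> continuous f2 ->
  continuous (fun uv => euler uv k).
Proof.
move=> cf1 cf2; elim: k => [|k IH] uv.
  have c1 : C01_const p.1 @[p --> uv] --> C01_const uv.1.
    have c : fst p @[p --> uv] --> uv.1 by exact: cvg_fst.
    exact: (cvg_comp _ _ c (C01_const_cts uv.1)).
  have c2 : C01_const p.2 @[p --> uv] --> C01_const uv.2.
    have c : snd p @[p --> uv] --> uv.2 by exact: cvg_snd.
    exact: (cvg_comp _ _ c (C01_const_cts uv.2)).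
  exact: (cvg_to_pair c1 c2).
have c1 : (euler p k).1 @[p --> uv] --> (euler uv k).1.
  exact: (cvg_comp _ _ (IH uv) cvg_fst).
have c2 : (euler p k).2 @[p --> uv] --> (euler uv k).2.
  exact: (cvg_comp _ _ (IH uv) cvg_snd).
pose t : I01 R := gridI n k.
have ev (g : R * R -> C01 R) :
    g p @[p --> uv] --> g uv -> g p t @[p --> uv] --> g uv t.
  move=> cg; have ct : (fun=> t) @ nbhs uv --> t by exact: cvg_cst.
  have cp : (g p, t) @[p --> uv] --> (g uv, t) by exact: (cvg_to_pair cg ct).
  exact: (cvg_comp _ _ cp (C01_eval_cts _ (g uv, t))).
have st (f : I01 R * (R * R) -> R) : continuous f ->
    f (t, ((euler p k).1 t, (euler p k).2 t)) @[p --> uv]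
      --> f (t, ((euler uv k).1 t, (euler uv k).2 t)).
  move=> cf; have ct : (fun=> t) @ nbhs uv --> t by exact: cvg_cst.
  have cp : (t, ((euler p k).1 t, (euler p k).2 t)) @[p --> uv] -->
      (t, ((euler uv k).1 t, (euler uv k).2 t)).
    apply: cvg_to_pair ct _.
    have e1 := ev (fun p => (euler p k).1) c1.
    have e2 := ev (fun p => (euler p k).2) c2.
    exact: (cvg_to_pair e1 e2).
  exact: (cvg_comp _ _ cp (cf (t, ((euler uv k).1 t, (euler uv k).2 t)))).
have d (g : R * R -> C01 R) (f : R * R -> R) : g p @[p --> uv] --> g uv ->
    f p @[p --> uv] --> f uv ->
    (g p + f p *: grid_ramp n k) @[p --> uv] --> g uv + f uv *: grid_ramp n k.
  by move=> cg cf; exact: cvgD cg (cvgZr_tmp cf).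
exact: (cvg_to_pair (d (fun p => (euler p k).1) _ c1 (st _ cf1))
  (d (fun p => (euler p k).2) _ c2 (st _ cf2))).
Qed.

Lemma eulerP (uv : R * R) : let xy := euler uv n.+1 in
  [/\ xy.1 (zero01 R) = uv.1, xy.2 (zero01 R) = uv.2,
      lagged_slope n.+1%:R^-1 (fun t => (euler_slopes xy t).1) xy.1 &
      lagged_slope n.+1%:R^-1 (fun t => (euler_slopes xy t).2) xy.2].
Proof.
have W1 k : (euler uv k.+1).1 = (euler uv k).1 +
  (euler_slopes (euler uv k) (gridI n k)).1 *: grid_ramp n k by [].
have W2 k : (euler uv k.+1).2 = (euler uv k).2 +
  (euler_slopes (euler uv k) (gridI n k)).2 *: grid_ramp n k by [].
have g0 : zero01 R = gridI n 0.
  by apply: val_inj; rewrite gridI_val//= /grid mul0r.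
(* Slopes computed during the construction are those of the final polygon. *)
have past k : (k <= n)%N -> euler_slopes (euler uv k) (gridI n k) =
    euler_slopes (euler uv n.+1) (gridI n k).
  move=> kn; rewrite /euler_slopes.
  rewrite (polygon_past n _ (fun k => (euler uv k).1) W1 k n.+1);
    last by rewrite leqnn leqW.
  rewrite (polygon_past n _ (fun k => (euler uv k).2) W2 k n.+1)//.
  by rewrite leqnn leqW.
split.
- by rewrite g0 (polygon_past n _ (fun k => (euler uv k).1) W1 0 n.+1) ?leqnn.
- by rewrite g0 (polygon_past n _ (fun k => (euler uv k).2) W2 0 n.+1) ?leqnn.
- apply: (polygon_lagged_slope n uv.1 _ (fun k => (euler uv k).1) erefl W1).
  by move=> k kn; rewrite past.
- apply: (polygon_lagged_slope n uv.2 _ (fun k => (euler uv k).2) erefl W2).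
  by move=> k kn; rewrite past.
Qed.

End euler.

Lemma lagged_slope_lipschitz (R : realType) (h : R) (G : I01 R -> R)
    (x : C01 R) (B : R) :
  (forall t, `|G t| <= B) -> lagged_slope h G x ->
  forall s t, `|x s - x t| <= B * `|\val s - \val t|.
Proof.
move=> GB slope.
have le s t : \val s <= \val t -> `|x t - x s| <= B * `|\val t - \val s|.
  move=> st; rewrite (@ger0_norm _ (\val t - \val s)) ?subr_ge0//.
  rewrite -[x t - x s]subr0 -(mul0r (\val t - \val s)).
  apply: (slope s t st 0 B) => tau _.
  by rewrite subr0.
move=> s t; have [st|/ltW ts] := leP (\val s) (\val t); last exact: le.
by rewrite distrC [X in _ * X]distrC le.
Qed.

Lemma lagged_slope_norm (R : realType) (h : R) (G : I01 R -> R)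
    (x : C01 R) (B : R) :
  (forall t, `|G t| <= B) -> lagged_slope h G x -> `|x| <= `|x (zero01 R)| + B.
Proof.
move=> GB slope; have [t tE] := C01_norm_max x.
rewrite -[`|x|]/(C01_norm x) tE -lerBlDl (le_trans (lerB_dist _ _))//.
rewrite (le_trans (lagged_slope_lipschitz _ h G x B GB slope t (zero01 R)))//.
have /andP[t0 t1] : 0 <= \val t <= 1.
  by have := set_mem (valP t); rewrite /I01 /= in_itv /=.
by rewrite /= subr0 ger0_norm// ler_piMr// (le_trans _ (GB t)).
Qed.

(** * A priori bounds *)

(** Substituting p <= M p + c into itself k times; the constant d is
    (1 + M + ... + M^(k-1)) c, the point being that it does not depend on p. *)
Lemma subinvariant_iterate (R : realType) (n : nat) (M : 'M[R]_n.+1)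
    (c : 'I_n.+1 -> R) :
  (forall i j, 0 <= M i j) ->
  forall k : nat, exists d : 'I_n.+1 -> R, forall p : 'I_n.+1 -> R,
    (forall i, p i <= \sum_j M i j * p j + c i) ->
    forall i, p i <= \sum_j (M ^+ k) i j * p j + d i.
Proof.
move=> M0; elim=> [|k [d dP]].
  exists (fun=> 0) => p _ i; rewrite addr0 (bigD1 i)//= expr0 mxE eqxx mul1r.
  by rewrite big1 ?addr0// => j /negPf ji; rewrite mxE eq_sym ji mul0r.
exists (fun i => \sum_j M i j * d j + c i) => p pM i.
apply: le_trans (pM i) _; rewrite addrA lerD2r.
rewrite (_ : \sum_j (M ^+ k.+1) i j * p j =
    \sum_l M i l * \sum_j (M ^+ k) l j * p j); last first.
  rewrite exprS.
  under eq_bigr => j _ do rewrite mxE mulr_suml.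
  rewrite exchange_big /=; apply: eq_bigr => l _; rewrite mulr_sumr.
  by apply: eq_bigr => j _; rewrite mulrA.
rewrite -big_split /=; apply: ler_sum => l _.
by rewrite -mulrDr ler_wpM2l// dP.
Qed.

(** Once the entries of M^k are below 1 / (2 (n + 1)), the iterated inequality
    reads max p <= (max p) / 2 + max d. *)
Lemma convergent_to_zero_bound (R : realType) (n : nat) (M : 'M[R]_n.+1)
    (c : 'I_n.+1 -> R) :
  (forall i j, 0 <= M i j) -> convergent_to_zero M ->
  exists r, forall p : 'I_n.+1 -> R, (forall i, 0 <= p i) ->
    (forall i, p i <= \sum_j M i j * p j + c i) -> forall i, p i <= r.
Proof.
move=> M0 Mcvg; pose e : R := (2 * n.+1%:R)^-1.
have e0 : 0 < e by rewrite invr_gt0 mulr_gt0.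
have [k kM] : exists k, `|M ^+ k| < e.
  by have [k kM] := filter_ex (cvgr0_norm_lt _ Mcvg _ e0); exists k.
have [d dP] := subinvariant_iterate R n M c M0 k.
exists (2 * \big[Num.max/0]_j d j) => p p0 pM.
have [i0 pmax] : exists i0, forall i, p i <= p i0.
  have [i0 _ iP] := arg_maxP p (erefl (predT (ord0 : 'I_n.+1))).
  by exists i0 => i; exact: iP.
suff : p i0 <= 2 * \big[Num.max/0]_j d j.
  by move=> H i; exact: le_trans (pmax i) H.
have dmax : d i0 <= \big[Num.max/0]_j d j by exact: le_bigmax.
have rows : \sum_j (M ^+ k) i0 j * p j <= \sum_(j < n.+1) e * p i0.
  apply: ler_sum => j _; apply: (@le_trans _ _ (`|M ^+ k| * p j)).
    rewrite ler_wpM2r// (le_trans (ler_norm _))//.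
    rewrite -[`|M ^+ k|]/(mx_norm (M ^+ k)) mx_normrE.
    pose entry (ij : 'I_n.+1 * 'I_n.+1) := `|(M ^+ k) ij.1 ij.2|.
    exact: (le_bigmax _ entry (i0, j)).
  by rewrite ler_pM// ltW.
have := dP p pM i0; rewrite sumr_const card_ord -mulr_natl mulrA in rows.
have ne : n.+1%:R * e = 2^-1.
  by rewrite /e invfM mulrCA divff// mulr1.
rewrite ne in rows; lra.
Qed.

(** One row of p <= M_theta p + c, where x and y stand for the norms of the
    two functions and u and v for the absolute values at 0.  In the first entry
    of the row, 1 / theta pays for the bare u in the bound on x, and
    a + theta A for the multiples of x. *)
Lemma weighted_norm_le (R : realType) (theta a b c A B C x y u v : R) :
  0 < theta -> 0 <= b -> 0 <= B -> 0 <= x -> 0 <= u -> 0 <= v ->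
  x <= u + (a * x + b * y + c) -> u <= A * x + B * y + C ->
  x + theta * u <= Num.max theta^-1 (a + theta * A) * (x + theta * u)
    + (b + theta * B) * (y + theta * v) + (c + theta * C).
Proof.
move=> th0 b0 B0 x0 u0 v0 xle ule.
have mth : u <= Num.max theta^-1 (a + theta * A) * (theta * u).
  rewrite mulrA -[X in X <= _]mul1r ler_wpM2r//.
  by rewrite -(mulVf (lt0r_neq0 th0)) ler_wpM2r ?(ltW th0)// le_max lexx.
have mx : (a + theta * A) * x <= Num.max theta^-1 (a + theta * A) * x.
  by rewrite ler_wpM2r// le_max lexx orbT.
have bv : 0 <= (b + theta * B) * (theta * v).
  by rewrite mulr_ge0 ?addr_ge0// mulr_ge0// ltW.
have thu : theta * u <= theta * (A * x + B * y + C) by rewrite ler_wpM2l// ltW.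
rewrite !mulrDr; move: mth mx bv thu; rewrite !mulrDl !mulrDr !mulrA.
move: (Num.max _ _) => m; lra.
Qed.

Lemma a_priori_bound (R : realType) (theta a1 b1 c1 a2 b2 c2 : R)
    (A1 B1 C1 A2 B2 C2 : R) :
  0 < theta -> 0 <= a1 -> 0 <= b1 -> 0 <= a2 -> 0 <= b2 ->
  0 <= A1 -> 0 <= B1 -> 0 <= A2 -> 0 <= B2 ->
  convergent_to_zero (M_theta theta a1 b1 a2 b2 A1 B1 A2 B2) ->
  exists r, forall x y u v, 0 <= x -> 0 <= y -> 0 <= u -> 0 <= v ->
    x <= u + (a1 * x + b1 * y + c1) -> y <= v + (a2 * x + b2 * y + c2) ->
    u <= A1 * x + B1 * y + C1 -> v <= A2 * x + B2 * y + C2 ->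
    x + theta * u <= r /\ y + theta * v <= r.
Proof.
move=> th0 a10 b10 a20 b20 A10 B10 A20 B20 Mcvg.
pose c (i : 'I_2) := if i == 0 then c1 + theta * C1 else c2 + theta * C2.
have M0 i j : 0 <= M_theta theta a1 b1 a2 b2 A1 B1 A2 B2 i j.
  rewrite mxE; case: (i == 0); case: (j == 0);
  rewrite ?le_max ?invr_ge0 ?(ltW th0)//;
  by rewrite addr_ge0// mulr_ge0 ?(ltW th0).
have [r rP] := convergent_to_zero_bound R 1 _ c M0 Mcvg.
exists r => x y u v x0 y0 u0 v0 xle yle ule vle.
pose p (i : 'I_2) := if i == 0 then x + theta * u else y + theta * v.
have p0 i : 0 <= p i.
  by rewrite /p; case: ifP => _; rewrite addr_ge0// mulr_ge0// ltW.
suff /(rP p p0) pr : forall i, p i <=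
    \sum_j M_theta theta a1 b1 a2 b2 A1 B1 A2 B2 i j * p j + c i.
  by split; [exact: (pr 0) | exact: (pr 1)].
move=> i; rewrite big_ord_recl big_ord1 !mxE /p /c.
case: (i == 0) => /=; first exact: weighted_norm_le.
rewrite [X in _ <= X + _]addrC; apply: weighted_norm_le => //.
  by rewrite [a2 * _ + _]addrC in yle.
by rewrite [A2 * _ + _]addrC in vle.
Qed.

(** * Approximate solutions *)

(** Brouwer's theorem applied to the initial values of the Euler polygons; the
    truncation at height [rho] keeps the map inside a square. *)
Lemma truncated_euler_bvp (R : realType) (f1 f2 : I01 R * (R * R) -> R)
    (alpha beta : C01 R * C01 R -> R) (rho : R) (n : nat) :
  continuous f1 -> continuous f2 -> continuous alpha -> continuous beta ->
  0 < rho ->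
  exists x y : C01 R,
    [/\ x (zero01 R) = clamp (- rho) rho (alpha (x, y)),
        y (zero01 R) = clamp (- rho) rho (beta (x, y)),
        lagged_slope n.+1%:R^-1 (fun t => f1 (t, (x t, y t))) x &
        lagged_slope n.+1%:R^-1 (fun t => f2 (t, (x t, y t))) y].
Proof.
move=> cf1 cf2 calpha cbeta rho0; pose Z p := euler f1 f2 n p n.+1.
have Zc : continuous Z by exact: euler_cts.
have cut_cts (g : C01 R * C01 R -> R) : continuous g ->
    continuous (fun p => clamp (- rho) rho (g (Z p))).
  move=> cg p; have gZ := cvg_comp _ _ (Zc p) (cg (Z p)).
  exact: (cvg_comp _ _ gZ (clamp_cts (- rho) rho _)).
have [uv [uE vE]] : exists p, clamp (- rho) rho (alpha (Z p)) = p.1 /\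
    clamp (- rho) rho (beta (Z p)) = p.2.
  apply: (brouwer_square R rho) => //; try exact: cut_cts;
  by move=> p; apply: clamp_norm_le; exact: ltW.
have := eulerP f1 f2 n uv; rewrite -/(Z uv); move: uE vE.
case: (Z uv) => x y uE vE [/= x0 y0 xslope yslope].
by exists x, y; rewrite uE vE.
Qed.

(** * Passage to the limit *)

Section limits.
Context {R : realType} {U : set_system nat} {UU : UltraFilter U}.

(** Arzela-Ascoli along an ultrafilter, where pointwise limits exist without
    extracting a subsequence.  Convergence is uniform because the points t_n
    where |x_n - g| is maximal converge as well, and the Lipschitz bound
    compares the values at t_n with those at the limit point. *)
Lemma ultra_ascoli (x : nat -> C01 R) (r K : R) :
  (forall n, `|x n| <= r) ->
  (forall n s t, `|x n s - x n t| <= K * `|\val s - \val t|) ->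
  exists l : C01 R, x @ U --> l.
Proof.
move=> xr xK.
have pt t : exists l : R, x n t @[n --> U] --> l.
  have [|l _ xl] := ultra_compact_cvg nat U _ `[- r, r] (fun n => x n t)
    (@segment_compact _ _ _).
    move=> n; rewrite /= in_itv /= -ler_norml.
    exact: (le_trans (C01_norm_ge (x n) t) (xr n)).
  by exists l.
have [g gP] := choice pt.
have gK s t : `|g s - g t| <= K * `|\val s - \val t|.
  have lim : `|x n s - x n t| @[n --> U] --> `|g s - g t|.
    by apply: cvg_norm; apply: cvgB.
  by apply: (ler_cvg_to lim (cvg_cst _)); apply: nearW => n; exact: xK.
have distI (t : I01 R) : `|\val s - \val t| @[s --> t] --> (0 : R).
  have vt : \val s @[s --> t] --> \val t by exact: initial_continuous.
  rewrite -(normr0 R) -(subrr (\val t)).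
  exact: (cvg_norm (cvgB vt (cvg_cst (\val t)))).
have g_cts : continuous g.
  move=> t; apply/(@subr_cvg0 _ _ _ (nbhs t)).
  apply/(@norm_cvg0P _ _ _ (nbhs t)).
  apply: (@squeeze_cvgr _ _ _ _ (cst 0)
    (fun s : I01 R => K * `|\val s - \val t|)).
  + by apply: nearW => s; rewrite normr_ge0 gK.
  + exact: cvg_cst.
  + by rewrite -(mulr0 K); apply: cvgM; [exact: cvg_cst | exact: distI].
exists (mkcts g_cts).
have /choice[t tP] n :
    exists t, `|x n - (mkcts g_cts : C01 R)| = `|x n t - g t|.
  have [t tE] := C01_norm_max (x n - (mkcts g_cts : C01 R)).
  by exists t; exact: tE.
have [l l01 tl] := ultra_compact_cvg nat U R (I01 R) (fun n => \val (t n))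
  (@segment_compact _ _ _) (fun n => set_mem (valP (t n))).
pose lI : I01 R := exist _ l (mem_set l01).
apply/subr_cvg0; apply/norm_cvg0P.
pose bound n :=
  K * `|\val (t n) - l| + K * `|\val (t n) - l| + `|x n lI - g lI|.
apply: (@squeeze_cvgr _ _ _ _ (cst 0) bound).
- apply: nearW => n; rewrite normr_ge0 tP /=.
  rewrite (_ : x n (t n) - g (t n) =
      (x n (t n) - x n lI) - (g (t n) - g lI) + (x n lI - g lI)); last by ring.
  rewrite (le_trans (ler_normD _ _))// lerD2r (le_trans (ler_normB _ _))//.
  by rewrite lerD// (xK, gK).
- exact: cvg_cst.
- have tl0 : K * `|\val (t n) - l| @[n --> U] --> (0 : R).
    rewrite -(mulr0 K); apply: cvgM; first exact: cvg_cst.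
    rewrite -(normr0 R) -(subrr l).
    by apply: cvg_norm; apply: cvgB tl (cvg_cst _).
  rewrite -[X in _ --> X]addr0 -[X in _ --> X + _]addr0.
  apply: cvgD; first exact: cvgD.
  rewrite -(normr0 R) -(subrr (g lI)).
  by apply: cvg_norm; apply: cvgB (gP _) (cvg_cst _).
Qed.

(** Near (t, infinity) the slopes f(tau, x_n(tau), y_n(tau)) are all close to
    L = f(t, x(t), y(t)), by joint continuity of evaluation.  Hence every chord
    of w_n between t and a nearby s has slope close to L, for almost all n, and
    so has the chord of w. *)
Lemma lagged_slope_limit (f : I01 R * (R * R) -> R) (xs ys ws : nat -> C01 R)
    (x y w : C01 R) :
  \oo `<=` U -> continuous f -> xs @ U --> x -> ys @ U --> y -> ws @ U --> w ->
  (forall n,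
    lagged_slope n.+1%:R^-1 (fun t => f (t, (xs n t, ys n t))) (ws n)) ->
  forall t, has_derivative01 w t (f (t, (x t, y t))).
Proof.
move=> Uoo cf xsx ysy wsw slope t; set L := f _.
have joint (zs : nat -> C01 R) (z : C01 R) : zs @ U --> z ->
    zs p.2 p.1 @[p --> filter_prod (nbhs t) U] --> z t.
  move=> zsz.
  have c1 : zs p.2 @[p --> filter_prod (nbhs t) U] --> z.
    exact: (cvg_comp _ _ cvg_snd zsz).
  have c2 : p.1 @[p --> filter_prod (nbhs t) U] --> t by exact: cvg_fst.
  exact: (cvg_comp _ _ (cvg_to_pair c1 c2) (C01_eval_cts R (z, t))).
have fL : f (p.1, (xs p.2 p.1, ys p.2 p.1))
    @[p --> filter_prod (nbhs t) U] --> L.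
  have c1 : p.1 @[p --> filter_prod (nbhs t) U] --> t by exact: cvg_fst.
  have c : (p.1, (xs p.2 p.1, ys p.2 p.1)) @[p --> filter_prod (nbhs t) U] -->
      (t, (x t, y t)).
    exact: (cvg_to_pair c1 (cvg_to_pair (joint xs x xsx) (joint ys y ysy))).
  exact: (cvg_comp _ _ c (cf (t, (x t, y t)))).
apply/cvgrPdist_le => e e0.
have [[P Q] /= [tP UQ] PQ] := cvgr_dist_le _ _ fL e e0.
have [d /= d0 dP] : nbhs_ball t P by apply/nbhs_ballP.
have d2 : 0 < d / 2 by rewrite divr_gt0.
have UQd : \forall n \near U, Q n /\ n.+1%:R^-1 < d / 2.
  apply: filterI => //; apply: Uoo.
  exact: (cvgr_lt _ (@cvg_harmonic R) _ d2).
(* A lag below d / 2 keeps the times tau of [s - h, t] or [t - h, s] within d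
   of t. *)
have step (s : I01 R) : `|\val s - \val t| < d / 2 ->
    `|w s - w t - L * (\val s - \val t)| <= e * `|\val s - \val t|.
  move=> std.
  have ev (z : I01 R) : ws n z @[n --> U] --> w z.
    have cz : (fun=> z) @ U --> z by exact: cvg_cst.
    exact: (cvg_comp _ _ (cvg_to_pair wsw cz) (C01_eval_cts R (w, z))).
  have lim : `|ws n s - ws n t - L * (\val s - \val t)| @[n --> U] -->
      `|w s - w t - L * (\val s - \val t)|.
    apply: cvg_norm; apply: cvgB (cvg_cst _); exact: cvgB.
  apply: (ler_cvg_to lim (cvg_cst _)); apply: filterS UQd => n [Qn nd].
  have near_L (tau : I01 R) : `|\val t - \val tau| < d ->
      `|f (tau, (xs n tau, ys n tau)) - L| <= e.
    by move=> td; rewrite distrC; apply: (PQ (tau, n)); split => //=; exact: dP.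
  move: std; rewrite ltr_distl => /andP[st1 st2].
  have [st|/ltW ts] := leP (\val s) (\val t).
    rewrite (@ler0_norm _ (\val s - \val t)) ?subr_le0// opprB -normrN.
    rewrite (_ : - (ws n s - ws n t - L * (\val s - \val t)) =
      ws n t - ws n s - L * (\val t - \val s)); last by ring.
    apply: slope => // tau /andP[t1 t2]; apply: near_L.
    move: (n.+1%:R^-1) nd t1 => h nd t1.
    by rewrite ltr_norml; apply/andP; split; lra.
  rewrite (@ger0_norm _ (\val s - \val t)) ?subr_ge0//.
  apply: slope => // tau /andP[t1 t2]; apply: near_L.
    move: (n.+1%:R^-1) nd t1 => h nd t1.
  by rewrite ltr_norml; apply/andP; split; lra.
have near_t : \forall s \near t, `|\val s - \val t| < d / 2.
  apply/nbhs_ballP; exists (d / 2) => //= s; rewrite distrC; exact.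
near=> s.
have st : \val s - \val t != 0.
  rewrite subr_eq0; apply/eqP => /val_inj; apply/eqP; near: s.
  exact: nbhs_dnbhs_neq.
have n0 : 0 < `|\val s - \val t| by rewrite normr_gt0.
rewrite -(ler_pM2r n0) -normrM mulrBl divfK// distrC; apply: step.
near: s; exact: nbhs_dnbhs.
Unshelve. all: by end_near. Qed.


End limits.

Theorem theorem3p1 (R : realType)
  (f1 f2 : I01 R * (R * R) -> R) (alpha beta : C01 R * C01 R -> R)
  (a1 b1 c1 a2 b2 c2 A1 B1 C1 A2 B2 C2 : R)
  (hf1 : continuous f1) (hf2 : continuous f2)
  (halpha : continuous alpha) (hbeta : continuous beta)
  (ha1 : 0 <= a1) (hb1 : 0 <= b1) (hc1 : 0 <= c1)
  (ha2 : 0 <= a2) (hb2 : 0 <= b2) (hc2 : 0 <= c2)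
  (hA1 : 0 <= A1) (hB1 : 0 <= B1) (hC1 : 0 <= C1)
  (hA2 : 0 <= A2) (hB2 : 0 <= B2) (hC2 : 0 <= C2)
  (hf1_growth : forall (t : I01 R) (x y : R),
    `|f1 (t, (x, y))| <= a1 * `|x| + b1 * `|y| + c1)
  (hf2_growth : forall (t : I01 R) (x y : R),
    `|f2 (t, (x, y))| <= a2 * `|x| + b2 * `|y| + c2)
  (halpha_growth : forall x y : C01 R,
    `|alpha (x, y)| <= A1 * `|x| + B1 * `|y| + C1)
  (hbeta_growth : forall x y : C01 R,
    `|beta (x, y)| <= A2 * `|x| + B2 * `|y| + C2)
  (hM : exists theta : R, 0 < theta /\
    convergent_to_zero (M_theta theta a1 b1 a2 b2 A1 B1 A2 B2)) :
  exists x y : C01 R, is_solution f1 f2 alpha beta x y.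

Proof.
have [theta [th0 Mcvg]] := hM.
have [r a_priori] := a_priori_bound R theta a1 b1 c1 a2 b2 c2 A1 B1 C1 A2 B2 C2
  th0 ha1 hb1 ha2 hb2 hA1 hB1 hA2 hB2 Mcvg.
have f1_bound (x y : C01 R) t :
    `|f1 (t, (x t, y t))| <= a1 * `|x| + b1 * `|y| + c1.
  rewrite (le_trans (hf1_growth _ _ _))// lerD2r lerD// ler_wpM2l//;
  exact: C01_norm_ge.
have f2_bound (x y : C01 R) t :
    `|f2 (t, (x t, y t))| <= a2 * `|x| + b2 * `|y| + c2.
  rewrite (le_trans (hf2_growth _ _ _))// lerD2r lerD// ler_wpM2l//;
  exact: C01_norm_ge.
(* The initial values are bounded by r / theta; one unit of slack keeps them
   strictly inside the truncation. *)
pose rho := `|r| / theta + 1.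
have rho0 : 0 < rho by rewrite ltr_wpDl// divr_ge0// ltW.
have euler_bvp n : exists xy : C01 R * C01 R,
    [/\ xy.1 (zero01 R) = alpha xy, xy.2 (zero01 R) = beta xy,
      lagged_slope n.+1%:R^-1 (fun t => f1 (t, (xy.1 t, xy.2 t))) xy.1 &
      lagged_slope n.+1%:R^-1 (fun t => f2 (t, (xy.1 t, xy.2 t))) xy.2] /\
    `|xy.1| <= r /\ `|xy.2| <= r.
  have [x [y [x0 y0 xslope yslope]]] :=
    truncated_euler_bvp R f1 f2 alpha beta rho n hf1 hf2 halpha hbeta rho0.
  have xb := lagged_slope_norm _ _ _ _ _ (f1_bound x y) xslope.
  have yb := lagged_slope_norm _ _ _ _ _ (f2_bound x y) yslope.
  (* Truncation does not increase absolute values, so the growth bounds on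
     alpha and beta already hold for the truncated conditions. *)
  have ule : `|x (zero01 R)| <= A1 * `|x| + B1 * `|y| + C1.
    by rewrite x0 (le_trans _ (halpha_growth x y))// clamp_norm_le_id// ltW.
  have vle : `|y (zero01 R)| <= A2 * `|x| + B2 * `|y| + C2.
    by rewrite y0 (le_trans _ (hbeta_growth x y))// clamp_norm_le_id// ltW.
  have [xr yr] := a_priori `|x| `|y| _ _ (normr_ge0 _) (normr_ge0 _)
    (normr_ge0 _) (normr_ge0 _) xb yb ule vle.
  have inside (z u : R) : 0 <= z -> z + theta * `|u| <= r -> `|u| < rho.
    move=> z0 zu; rewrite (@le_lt_trans _ _ (`|r| / theta)) ?ltrDl//.
    rewrite ler_pdivlMr// mulrC (le_trans _ (ler_norm r))//.
    by rewrite (le_trans _ zu)// lerDr.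
  exists (x, y); split => /=; last first.
    split; [apply: le_trans xr|apply: le_trans yr];
    by rewrite lerDl mulr_ge0 ?(ltW th0).
  split => //=.
    rewrite x0 clamp_interior// -x0; exact: inside xr.
  rewrite y0 clamp_interior// -y0; exact: inside yr.
have [xy xyP] := choice euler_bvp.
have [U [UU Uoo]] := ultraFilterLemma (F := \oo) _.
have r0 : 0 <= r by have [_ [x0r _]] := xyP 0%N; exact: le_trans x0r.
have [x xsx] : exists x : C01 R, (xy n).1 @[n --> U] --> x.
  apply: (ultra_ascoli _ r (a1 * r + b1 * r + c1)) => n;
    have [[_ _ xslope _] [xr yr]] := xyP n => //.
  apply: lagged_slope_lipschitz xslope => t.
  by rewrite (le_trans (f1_bound _ _ _))// !lerD2r lerD// ler_wpM2l.
have [y ysy] : exists y : C01 R, (xy n).2 @[n --> U] --> y.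
  apply: (ultra_ascoli _ r (a2 * r + b2 * r + c2)) => n;
    have [[_ _ _ yslope] [xr yr]] := xyP n => //.
  apply: lagged_slope_lipschitz yslope => t.
  by rewrite (le_trans (f2_bound _ _ _))// !lerD2r lerD// ler_wpM2l.
have dx : forall t, has_derivative01 x t (f1 (t, (x t, y t))).
  apply: (lagged_slope_limit _ _ _ _ _ _ _ Uoo hf1 xsx ysy xsx) => n.
  by have [[]] := xyP n.
have dy : forall t, has_derivative01 y t (f2 (t, (x t, y t))).
  apply: (lagged_slope_limit _ _ _ _ _ _ _ Uoo hf2 xsx ysy ysy) => n.
  by have [[]] := xyP n.
have rhs_cts (f : I01 R * (R * R) -> R) : continuous f ->
    continuous (fun t => f (t, (x t, y t))).
  move=> cf t; have ct : s @[s --> t] --> t by exact: cvg_id.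
  have cx : x s @[s --> t] --> x t by exact: C01_cts.
  have cy : y s @[s --> t] --> y t by exact: C01_cts.
  have cs : (s, (x s, y s)) @[s --> t] --> (t, (x t, y t)).
    exact: (cvg_to_pair ct (cvg_to_pair cx cy)).
  exact: (cvg_comp _ _ cs (cf (t, (x t, y t)))).
have ev (z : nat -> C01 R) (l : C01 R) : z @ U --> l ->
    z n (zero01 R) @[n --> U] --> l (zero01 R).
  move=> zl; have c0 : (fun=> zero01 R) @ U --> zero01 R by exact: cvg_cst.
  exact: (cvg_comp _ _ (cvg_to_pair zl c0) (C01_eval_cts R (l, zero01 R))).
have xyl : xy n @[n --> U] --> (x, y).
  rewrite (_ : xy = fun n => ((xy n).1, (xy n).2)).
    exact: cvg_to_pair xsx ysy.
  by apply/funext => n; case: (xy n).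
exists x, y; split => //.
- split; [exists (mkcts (rhs_cts f1 hf1)) | exists (mkcts (rhs_cts f2 hf2))];
  move=> t; [exact: dx | exact: dy].
- have lim : (xy n).1 (zero01 R) @[n --> U] --> alpha (x, y).
    have -> : (fun n => (xy n).1 (zero01 R)) = alpha \o xy.
      by apply/funext => n; have [[]] := xyP n.
    exact: (cvg_comp _ _ xyl (halpha (x, y))).
  exact: (cvg_unique _ (ev _ _ xsx) lim).
- have lim : (xy n).2 (zero01 R) @[n --> U] --> beta (x, y).
    have -> : (fun n => (xy n).2 (zero01 R)) = beta \o xy.
      by apply/funext => n; have [[]] := xyP n.
    exact: (cvg_comp _ _ xyl (hbeta (x, y))).
  exact: (cvg_unique _ (ev _ _ ysy) lim).
Qed.
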